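(* Let $T=3$, $L=\ell=2$, and suppose $\overline{V}\ge\underline{C}+V$ and $\overline{C}-\overline{V}-V\ge 0$. Then $\mathrm{conv}(P)$ is the set of all $(x_1,x_2,x_3,y_1,y_2,y_3,u_2,u_3)\in\mathbb{R}^8$ satisfying \begin{align*} & u_2+u_3\le y_3,\qquad y_1+u_2+u_3\le 1,\\ & u_2\ge y_2-y_1,\quad u_3\ge y_3-y_2,\quad u_2\ge 0,\quad u_3\ge 0,\\ & x_1\ge\underline{C}y_1,\quad x_2\ge\underline{C}y_2,\quad x_3\ge\underline{C}y_3,\\ & x_1\le\overline{V}y_1+V(y_2-u_2)+(\overline{C}-\overline{V}-V)(y_3-u_3-u_2),\\ & x_2\le\overline{V}y_2+(\overline{C}-\overline{V})(y_3-u_3-u_2),\\ & x_3\le\overline{C}y_3-(\overline{C}-\overline{V})u_3-(\overline{C}-\overline{V}-V)u_2,\\ & x_2-x_1\le(\underline{C}+V)y_2-\underline{C}y_1-(\underline{C}+V-\overline{V})u_2,\\ & x_3-x_2\le(\underline{C}+V)y_3-\underline{C}y_2-(\underline{C}+V-\overline{V})u_3,\\ & x_1-x_2\le\overline{V}y_1-(\overline{V}-V)y_2-(\underline{C}+V-\overline{V})u_2,\\ & x_2-x_3\le\overline{V}y_2-(\overline{V}-V)y_3-(\underline{C}+V-\overline{V})u_3,\\ & x_3-x_1\le(\underline{C}+2V)y_3-\underline{C}y_1-(\underline{C}+2V-\overline{V})u_3-(\underline{C}+V-\overline{V})u_2,\\ & x_1-x_3\le\overline{V}y_1-\underline{C}y_3+V(y_2-u_2)+(\underline{C}+V-\overline{V})(y_3-u_3-u_2),\\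 & x_1-x_2+x_3\le\overline{V}y_1-(\overline{V}-V)y_2+\overline{V}y_3+(\overline{C}-\overline{V})(y_3-u_3-u_2),\\ & x_1-x_2+x_3\ge\underline{C}y_1-(\underline{C}+V)y_2+\underline{C}y_3. \end{align*}
   Context: $T$ is the number of time periods, $L,\ell$ are positive integers (minimum-up and minimum-down time), and $\underline{C},\overline{C},\overline{V},V$ are real parameters (generation lower bound, generation upper bound, start-up/shut-down ramp rate, ramp rate in the stable region) with $0\le\underline{C}\le\overline{V}\le\overline{C}$ and $V>0$. For integers $a,b$, $[a,b]_{\mathbb{Z}}$ is the set of integers $i$ with $a\le i\le b$. $P$ is the set of $(x,y,u)\in\mathbb{R}_+^T\times\{0,1\}^T\times\{0,1\}^{T-1}$, with $x=(x_1,\dots,x_T)$, $y=(y_1,\dots,y_T)$, $u=(u_2,\dots,u_T)$, such that \begin{align*} &\textstyle\sum_{i=t-L+1}^{t}u_i\le y_t,\ t\in[L+1,T]_{\mathbb{Z}};\qquad \sum_{i=t-\ell+1}^{t}u_i\le 1-y_{t-\ell},\ t\in[\ell+1,T]_{\mathbb{Z}};\\ &y_t-y_{t-1}-u_t\le 0,\ t\in[2,T]_{\mathbb{Z}};\qquad \underline{C}y_t\le x_t\le\overline{C}y_t,\ t\in[1,T]_{\mathbb{Z}};\\ &x_t-x_{t-1}\le Vy_{t-1}+\overline{V}(1-y_{t-1}),\ t\in[2,T]_{\mathbb{Z}};\qquad x_{t-1}-x_t\le Vy_t+\overline{V}(1-y_t),\ t\in[2,T]_{\mathbb{Z}}. \end{align*}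 $\mathrm{conv}(P)$ denotes the convex hull of $P$. *)

(* Defs.v *)
From mathcomp Require Import all_boot all_order all_algebra.
From mathcomp Require Import classical_sets reals convex.

Set Implicit Arguments.
Unset Strict Implicit.
Unset Printing Implicit Defensive.

Import Order.TTheory GRing.Theory Num.Theory.
Local Open Scope classical_set_scope.
Local Open Scope ring_scope.

Definition convex_hull (R : numDomainType) (E : lmodType R) (A : set E) :
    set E :=
  smallest (@convex_set R E) A.

(* A triple (x, y, u) in R^T x R^T x R^(T-1). *)
Definition schedule (R : realType) (T : nat) : lmodType R :=
  ('rV[R]_T * 'rV[R]_T * 'rV[R]_(T.-1))%type.

(* Coordinate k, counted from 0; the value 0 for k >= n is a dummy that is
   not reached by the constraints below. *)
Definition entry (R : realType) (n : nat) (v : 'rV[R]_n) (k : nat) : R :=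
  if insub k is Some i then v 0 i else 0.

(* The time indices are those of x = (x_1, ..., x_T), y = (y_1, ..., y_T) and
   u = (u_2, ..., u_T). *)
Definition xvar (R : realType) (T : nat) (p : schedule R T) (t : nat) : R :=
  entry p.1.1 (t - 1).
Definition yvar (R : realType) (T : nat) (p : schedule R T) (t : nat) : R :=
  entry p.1.2 (t - 1).
Definition uvar (R : realType) (T : nat) (p : schedule R T) (t : nat) : R :=
  entry p.2 (t - 2).

(* L, l: minimum-up and minimum-down times; Clo, Cup: generation bounds;
   Vbar: start-up/shut-down ramp rate; V: stable ramp rate.
   For 0 < L and L < t the truncated difference t - L is the integer one, and
   (t - L).+1 <= i < t.+1 is the range t - L + 1 <= i <= t; likewise for l. *)
Definition P (R : realType) (T L l : nat) (Clo Cup Vbar V : R) :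
    set (schedule R T) :=
  [set p |
    let x := xvar p in let y := yvar p in let u := uvar p in
    (forall t, (1 <= t <= T)%N -> 0 <= x t) /\
    (forall t, (1 <= t <= T)%N -> y t = 0 \/ y t = 1) /\
    (forall t, (2 <= t <= T)%N -> u t = 0 \/ u t = 1) /\
    (forall t, (L.+1 <= t <= T)%N ->
       \sum_((t - L).+1 <= i < t.+1) u i <= y t) /\
    (forall t, (l.+1 <= t <= T)%N ->
       \sum_((t - l).+1 <= i < t.+1) u i <= 1 - y (t - l)%N) /\
    (forall t, (2 <= t <= T)%N -> y t - y (t - 1)%N - u t <= 0) /\
    (forall t, (1 <= t <= T)%N -> Clo * y t <= x t /\ x t <= Cup * y t) /\
    (forall t, (2 <= t <= T)%N ->
       x t - x (t - 1)%N <= V * y (t - 1)%N + Vbar * (1 - y (t - 1)%N)) /\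
    (forall t, (2 <= t <= T)%N ->
       x (t - 1)%N - x t <= V * y t + Vbar * (1 - y t))].
Arguments P {R} T L l Clo Cup Vbar V.

(* Main.v *)
(* The only commitments (y, u) admitted by P for T = 3 are off throughout, 100,
   110, 111, 011 and 001, and they are affinely independent; hence y and u
   determine the weight of each of them, namely y1 - y2 + u2 for 100, y2 - y3 +
   u3 for 110, y3 - u2 - u3 for 111, u2 for 011 and u3 for 001. It remains to
   split x into productions of these modes, scaled by the weights. Once the
   middle production x2 is split into p (110), q (111) and r (011), the
   splittings of x1 and of x3 are independent of each other, and each exists
   iff finitely many bounds on p, q, r, p + q, q + r hold. As p + q + r = x2, a
   bound on p + q is one on r and a bound on q + r is one on p, so p, q and r
   are only constrained to intervals and to sum to x2; the conditions for this
   are the inequalities of the theorem. *)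
Require Import Defs.
From mathcomp Require Import all_boot all_order all_algebra.
From mathcomp Require Import classical_sets reals convex.
From mathcomp Require Import interval_inference lra.

Set Implicit Arguments.
Unset Strict Implicit.
Unset Printing Implicit Defensive.

Import Order.TTheory GRing.Theory Num.Theory.
Local Open Scope classical_set_scope.
Local Open Scope ring_scope.

(** * Splitting productions under interval constraints *)

Lemma exists_max2 (R : realFieldType) (l1 l2 : R) :
  exists m, [/\ l1 <= m, l2 <= m & m = l1 \/ m = l2].
Proof.
have [h|h] := lerP l1 l2; first by exists l2; split; [| | right].
by exists l1; split; [| exact: ltW | left].
Qed.

Lemma exists_max3 (R : realFieldType) (l1 l2 l3 : R) :
  exists m, [/\ l1 <= m, l2 <= m, l3 <= m & [\/ m = l1, m = l2 | m = l3]].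
Proof.
have [m' [h1 h2 h12]] := exists_max2 l1 l2.
have [m [hm' h3 hm]] := exists_max2 m' l3.
exists m; split; [exact: le_trans hm' | exact: le_trans hm' | by [] |].
case: hm h12 => -> [] E; first [exact: Or33 | rewrite E].
- exact: Or31.
- exact: Or32.
Qed.

Lemma exists_min2 (R : realFieldType) (u1 u2 : R) :
  exists m, [/\ m <= u1, m <= u2 & m = u1 \/ m = u2].
Proof.
have [h|h] := lerP u1 u2; first by exists u1; split; [| | left].
by exists u2; split; [exact: ltW | | right].
Qed.

Lemma exists_min3 (R : realFieldType) (u1 u2 u3 : R) :
  exists m, [/\ m <= u1, m <= u2, m <= u3 & [\/ m = u1, m = u2 | m = u3]].
Proof.
have [m [h1 h2 h3 h]] := exists_max3 (- u1) (- u2) (- u3).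
exists (- m); split; [lra | lra | lra | case: h => ->; rewrite opprK].
- exact: Or31.
- exact: Or32.
- exact: Or33.
Qed.

(** Greedy filling: all three summands start at their lower bounds and are raised to their upper
    bounds one after another until the sum reaches x. *)
Lemma sum3_itv (R : realFieldType) (l1 l2 l3 u1 u2 u3 x : R) :
    l1 <= u1 -> l2 <= u2 -> l3 <= u3 ->
    l1 + l2 + l3 <= x <= u1 + u2 + u3 ->
  exists z1 z2 z3, [/\ z1 + z2 + z3 = x, l1 <= z1 <= u1, l2 <= z2 <= u2
    & l3 <= z3 <= u3].
Proof.
move=> h1 h2 h3 /andP[hl hu].
have [h|h] := lerP x (u1 + l2 + l3).
  by exists (x - l2 - l3), l2, l3; split; [lra | apply/andP; split; lra ..].
have [h'|h'] := lerP x (u1 + u2 + l3).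
  by exists u1, (x - u1 - l3), l3; split; [lra | apply/andP; split; lra ..].
by exists u1, u2, (x - u1 - u2); split; [lra | apply/andP; split; lra ..].
Qed.

(* At an end of the horizon, x is the production of the modes that are on only
   there (in [aL, aU]), there and in the middle period, and in all three periods;
   p and q are the middle productions of the last two. *)
Lemma end_period_split (R : realFieldType) (aL aU bL bV cL cU cV p q x : R) :
    aL <= aU -> 0 <= bV -> 0 <= cV -> bL <= p -> cL <= q <= cU ->
    aL + bL + cL <= x ->
    aL + (p - bV) + cL <= x ->
    aL + bL + (q - cV) <= x ->
    aL + (p - bV) + (q - cV) <= x ->
    x <= aU + (p + bV) + cU ->
    x <= aU + (p + bV) + (q + cV) ->
  exists xa xb xc, [/\ xa + xb + xc = x,
    aL <= xa <= aU,
    [/\ bL <= xb, p - bV <= xb & xb <= p + bV] &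
    [/\ cL <= xc, q - cV <= xc, xc <= cU & xc <= q + cV]].
Proof.
move=> ha hb hc hp /andP[q1 q2] L1 L2 L3 L4 U1 U2.
have [lb [lb1 lb2 lbE]] := exists_max2 bL (p - bV).
have [lc [lc1 lc2 lcE]] := exists_max2 cL (q - cV).
have [uc [uc1 uc2 ucE]] := exists_min2 cU (q + cV).
(* Each of [lb], [lc], [uc] equals one of its candidates, so every comparison reduces to hypotheses
   of the lemma. *)
have [h2 h3 h4 h5] : [/\ lb <= p + bV, lc <= uc, aL + lb + lc <= x
    & x <= aU + (p + bV) + uc].
  clear lb1 lb2 lc1 lc2 uc1 uc2; split.
  - by case: lbE => ->; lra.
  - by case: lcE => ->; case: ucE => ->; lra.
  - by case: lbE => ->; case: lcE => ->.
  - by case: ucE => ->.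
have [|xa [xb [xc [xE xaP /andP[? ?] /andP[? ?]]]]] :=
  sum3_itv ha h2 h3 (x := x); first by rewrite h4 h5.
exists xa, xb, xc; split => //; split => //.
- exact: le_trans lb1 _.
- exact: le_trans lb2 _.
- exact: le_trans lc1 _.
- exact: le_trans lc2 _.
- exact: le_trans uc1.
- exact: le_trans uc2.
Qed.

(** The letters a to e stand for the modes 100, 110, 111, 011 and 001. The bounds, to be scaled by
    the weights of the modes, are free parameters here, which keeps all conditions linear. *)
Lemma production_split (R : realFieldType)
    (aL aU bL bU bV cL cU cV dL dU dV eL eU x1 x2 x3 : R) :
    0 <= bV -> 0 <= cV -> 0 <= dV ->
    aL <= aU -> bL + bV <= bU -> cL + 2 * cV <= cU -> dL + dV <= dU ->
    eL <= eU ->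
    aL + bL + cL <= x1 -> bL + cL + dL <= x2 -> cL + dL + eL <= x3 ->
    x1 <= aU + (bU + bV) + cU ->
    x2 <= bU + cU + dU ->
    x3 <= cU + (dU + dV) + eU ->
    x2 - x1 <= - aL + bV + cV + dU ->
    x3 - x2 <= - bL + cV + dV + eU ->
    x1 - x2 <= aU + bV + cV - dL ->
    x2 - x3 <= bU + cV + dV - eL ->
    x3 - x1 <= - aL - bL + 2 * cV + (dU + dV) + eU ->
    x1 - x3 <= aU + (bU + bV) + 2 * cV - dL - eL ->
    x1 - x2 + x3 <= aU + bV + (cU + cV) + dV + eU ->
    x1 - x2 + x3 >= aL - bV + (cL - cV) - dV + eL ->
  exists xa xb1 xb2 xc1 xc2 xc3 xd2 xd3 xe,
    [/\ [/\ xa + xb1 + xc1 = x1, xb2 + xc2 + xd2 = x2 & xe + xd3 + xc3 = x3],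
    aL <= xa <= aU /\ eL <= xe <= eU,
    bL <= xb2 <= bU /\ [/\ bL <= xb1, xb2 - bV <= xb1 & xb1 <= xb2 + bV],
    dL <= xd2 <= dU /\ [/\ dL <= xd3, xd2 - dV <= xd3 & xd3 <= xd2 + dV] &
    [/\ cL <= xc2 <= cU,
    [/\ cL <= xc1, xc2 - cV <= xc1, xc1 <= cU & xc1 <= xc2 + cV] &
    [/\ cL <= xc3, xc2 - cV <= xc3, xc3 <= cU & xc3 <= xc2 + cV]]].
Proof.
move=> hbV hcV hdV ha hb hc hd he i1 i2 i3 i4 i5 i6 i7 i8 i9 i10 i11 i12 i13 i14.
(* The bounds on x1 and x3 in [end_period_split], solved for each of the three
   middle productions; a bound on a sum of two of them is one on the third. *)
have [lp [lp1 lp2 lp3 lpE]] := exists_max3 bL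
  (x1 - aU - bV - cU) (x2 - x3 + eL - dV - cV).
have [up [up1 up2 up3 upE]] := exists_min3 bU
  (x1 - aL + bV - cL) (x2 - x3 + eU + dV + cV).
have [uq [uq1 uq2 uq3 uqE]] := exists_min3 cU
  (x1 - aL - bL + cV) (x3 - eL - dL + cV).
have [lr [lr1 lr2 lr3 lrE]] := exists_max3 dL
  (x3 - eU - dV - cU) (x2 - x1 + aL - bV - cV).
have [ur [ur1 ur2 ur3 urE]] := exists_min3 dU
  (x3 - eL + dV - cL) (x2 - x1 + aU + bV + cV).
(* Comparing candidates in [lp <= up] and [lr <= ur] produces, among others, the two conditions on
   x1 - x2 + x3; the sum [up + uq + ur] produces those on x3 - x1 and x1 - x3. *)
have [hp hq hr hL hU] : [/\ lp <= up, cL <= uq, lr <= ur,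
    lp + cL + lr <= x2 & x2 <= up + uq + ur].
  clear lp1 lp2 lp3 up1 up2 up3 uq1 uq2 uq3 lr1 lr2 lr3 ur1 ur2 ur3.
  split.
  - by case: lpE => ->; case: upE => ->; lra.
  - by case: uqE => ->; lra.
  - by case: lrE => ->; case: urE => ->; lra.
  - by case: lpE => ->; case: lrE => ->; lra.
  - by case: upE => ->; case: uqE => ->; case: urE => ->; lra.
have [|p [q [r [x2E /andP[p1 p2] /andP[q1 q2] /andP[r1 r2]]]]] :=
  sum3_itv hp hq hr (x := x2); first by rewrite hL hU.
have bp1 := le_trans lp1 p1; have bp2 := le_trans p2 up1.
have dr1 := le_trans lr1 r1; have dr2 := le_trans r2 ur1.
have cq : cL <= q <= cU by rewrite q1 (le_trans q2 uq1).
have [||||||xa [xb1 [xc1 [? ? ? ?]]]] :=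
  end_period_split ha hbV hcV bp1 cq (x := x1);
    [move: i1 | move: p2 up2 | move: q2 uq2 | move: r1 lr3 x2E | move: p1 lp2
    | move: r2 ur3 x2E | ]; [clear; lra ..|].
have [||||||xe [xd3 [xc3 [? ? ? ?]]]] :=
  end_period_split he hdV hcV dr1 cq (x := x3);
    [move: i3 | move: r2 ur2 | move: q2 uq3 | move: p1 lp3 x2E | move: r1 lr2
    | move: p2 up3 x2E | ]; [clear; lra ..|].
by exists xa, xb1, p, xc1, q, xc3, r, xd3, xe; rewrite bp1 bp2 dr1 dr2.
Qed.

(** * Convex hulls and multiples of convex sets *)

Lemma convex_setP (R : realFieldType) (E : lmodType R) (A : set E) :
  convex_set A <->
  forall x y t, 0 <= t -> t <= 1 -> A x -> A y -> A (t *: x + (1 - t) *: y).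
Proof.
split=> [cA x y t t0 t1 Ax Ay | cA x y t].
  by move: (cA x y (Itv01 t0 t1)); rewrite !inE; apply.
by rewrite !inE; apply: cA.
Qed.

Lemma convex_set_hull (R : realFieldType) (E : lmodType R) (A : set E) :
  convex_set (convex_hull A).
Proof.
apply/convex_setP => x y t t0 t1 Ax Ay M [cM AM].
by move/convex_setP: (cM); apply => //; [apply: Ax | apply: Ay].
Qed.

(** Adding multiples of points of [K] replaces convex combinations of several points: the weights,
    possibly zero, simply add up. *)
Definition scaled (R : realFieldType) (E : lmodType R) (K : set E) (c : R)
    (x : E) : Prop :=
  exists2 v, K v & x = c *: v.

(** If a + b > 0, the sum is a + b times the convex combination of the two points with weights a /
    (a + b) and b / (a + b). *)
Lemma scaledD (R : realFieldType) (E : lmodType R) (K : set E) (a b : R)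
    (x y : E) :
  convex_set K -> 0 <= a -> 0 <= b ->
  scaled K a x -> scaled K b y -> scaled K (a + b) (x + y).
Proof.
move=> /convex_setP cK a0 b0 [v Kv ->] [w Kw ->].
have [ab0|ab0] := eqVneq (a + b) 0.
  have a00 : a = 0 by lra.
  have b00 : b = 0 by lra.
  by exists v => //; rewrite a00 b00 !(scale0r, addr0).
have abgt0 : 0 < a + b by rewrite lt_neqAle eq_sym ab0 addr_ge0.
exists ((a / (a + b)) *: v + (1 - a / (a + b)) *: w).
  apply: cK => //; first by rewrite divr_ge0 ?addr_ge0.
  by rewrite ler_pdivrMr // mul1r lerDl.
rewrite scalerDr !scalerA mulrBr mulr1 mulrCA divff // mulr1.
by rewrite addrAC subrr add0r.
Qed.

(** * Schedules with three periods in coordinates *)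

Section Coordinates.
Variable R : realType.

Lemma entryE n (v : 'rV[R]_n) (i : 'I_n) : entry v i = v 0 i.
Proof. by rewrite /entry valK. Qed.

Definition point3 (x1 x2 x3 y1 y2 y3 u2 u3 : R) : schedule R 3 :=
  (\row_(i < 3) [:: x1; x2; x3]`_i, \row_(i < 3) [:: y1; y2; y3]`_i,
   \row_(i < 2) [:: u2; u3]`_i).

Lemma point3_coords x1 x2 x3 y1 y2 y3 u2 u3
    (p := point3 x1 x2 x3 y1 y2 y3 u2 u3) :
  (xvar p 1 = x1) * (xvar p 2 = x2) * (xvar p 3 = x3) *
  (yvar p 1 = y1) * (yvar p 2 = y2) * (yvar p 3 = y3) *
  (uvar p 2 = u2) * (uvar p 3 = u3).
Proof.
rewrite /xvar /yvar /uvar /=; split; rewrite /entry; do 7?[split];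
  by rewrite insubT //= mxE.
Qed.

Lemma point3_eta (p : schedule R 3) :
  p = point3 (xvar p 1) (xvar p 2) (xvar p 3) (yvar p 1) (yvar p 2) (yvar p 3)
        (uvar p 2) (uvar p 3).
Proof.
case: p => [[x y] u]; congr (_, _, _); apply/rowP => i; rewrite mxE -entryE;
  by case: i => [[|[|[|i]]] ?].
Qed.

Lemma point3D x1 x2 x3 y1 y2 y3 u2 u3 x1' x2' x3' y1' y2' y3' u2' u3' :
  point3 x1 x2 x3 y1 y2 y3 u2 u3 + point3 x1' x2' x3' y1' y2' y3' u2' u3' =
  point3 (x1 + x1') (x2 + x2') (x3 + x3') (y1 + y1') (y2 + y2') (y3 + y3')
    (u2 + u2') (u3 + u3').
Proof.
by congr (_, _, _); apply/rowP => i; rewrite !mxE; case: i => [[|[|[|i]]] ?].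
Qed.

Lemma point3Z c x1 x2 x3 y1 y2 y3 u2 u3 :
  c *: point3 x1 x2 x3 y1 y2 y3 u2 u3 =
  point3 (c * x1) (c * x2) (c * x3) (c * y1) (c * y2) (c * y3)
    (c * u2) (c * u3).
Proof.
by congr (_, _, _); apply/rowP => i; rewrite !mxE; case: i => [[|[|[|i]]] ?].
Qed.

End Coordinates.

(** * The set [P] for T = 3 and L = l = 2 *)

Definition commitment3 (R : numDomainType) (y1 y2 y3 u2 u3 : R) : Prop :=
  [/\ [/\ y1 = 0 \/ y1 = 1, y2 = 0 \/ y2 = 1 & y3 = 0 \/ y3 = 1],
      (u2 = 0 \/ u2 = 1) /\ (u3 = 0 \/ u3 = 1),
      u2 + u3 <= y3 /\ u2 + u3 <= 1 - y1 &
      y2 - y1 - u2 <= 0 /\ y3 - y2 - u3 <= 0].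

(* The constraints of P on x, homogenized by the weight c of the commitment. *)
Definition production3 (R : numDomainType) (Clo Cup Vbar V c : R)
    (y1 y2 y3 x1 x2 x3 : R) : Prop :=
  [/\ [/\ c * (Clo * y1) <= x1, c * (Clo * y2) <= x2 & c * (Clo * y3) <= x3],
      [/\ x1 <= c * (Cup * y1), x2 <= c * (Cup * y2) & x3 <= c * (Cup * y3)],
      x2 - x1 <= c * (V * y1 + Vbar * (1 - y1)) /\
      x3 - x2 <= c * (V * y2 + Vbar * (1 - y2)) &
      x1 - x2 <= c * (V * y2 + Vbar * (1 - y2)) /\
      x2 - x3 <= c * (V * y3 + Vbar * (1 - y3))].

Lemma P3E (R : realType) (Clo Cup Vbar V : R) x1 x2 x3 y1 y2 y3 u2 u3 :
  0 <= Clo ->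
  P 3 2 2 Clo Cup Vbar V (point3 x1 x2 x3 y1 y2 y3 u2 u3) <->
  commitment3 y1 y2 y3 u2 u3 /\
  production3 Clo Cup Vbar V 1 y1 y2 y3 x1 x2 x3.
Proof.
move=> hClo; rewrite /P /commitment3 /production3 /=.
set p := point3 _ _ _ _ _ _ _ _.
(* The up-time and down-time constraints concern t = 3 alone, and both sums run over u_2 and u_3. *)
have sumu : \sum_(2 <= i < 4) uvar p i = u2 + u3.
  by rewrite big_nat_recl // big_nat1 !point3_coords.
split.
- case=> [_ [yB [uB [hL [hl [hu [hx [hup hdn]]]]]]]].
  move: (yB 1 isT) (yB 2 isT) (yB 3 isT) (uB 2 isT) (uB 3 isT) (hL 3 isT)
    (hl 3 isT) (hu 2 isT) (hu 3 isT) (hx 1 isT) (hx 2 isT) (hx 3 isT)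
    (hup 2 isT) (hup 3 isT) (hdn 2 isT) (hdn 3 isT).
  rewrite !subnE /= sumu !point3_coords !mul1r.
  move=> ? ? ? ? ? ? ? ? ? [? ?] [? ?] [? ?] *.
  by do !split.
- case=> [[[yB1 yB2 yB3] [uB2 uB3] [hL hl] [hu2 hu3]]].
  rewrite !mul1r => -[[l1 l2 l3] [c1 c2 c3] [p2 p3] [d2 d3]].
  (* The constraint 0 <= x of [P] is recovered from [Clo * y <= x]. *)
  have y0 y : y = 0 \/ y = 1 -> 0 <= Clo * y.
    by case=> ->; rewrite ?mulr0 ?mulr1.
  have := (y0 _ yB1, y0 _ yB2, y0 _ yB3) => -[[? ?] ?].
  split; [|split; [|split; [|split; [|split; [|split; [|split; [|split]]]]]]].
  all: case=> [|[|[|[|t]]]] // _; rewrite ?subnE /= ?sumu !point3_coords.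
  all: by first [done | split; lra | lra].
Qed.

Lemma scaled_P3 (R : realType) (Clo Cup Vbar V c : R)
    x1 x2 x3 y1 y2 y3 u2 u3 :
  0 <= Clo -> 0 < V -> Clo <= Vbar -> Vbar <= Cup -> 0 <= c ->
  commitment3 y1 y2 y3 u2 u3 ->
  production3 Clo Cup Vbar V c y1 y2 y3 x1 x2 x3 ->
  scaled (P 3 2 2 Clo Cup Vbar V) c
    (point3 x1 x2 x3 (c * y1) (c * y2) (c * y3) (c * u2) (c * u3)).
Proof.
move=> hClo hV hVb hCu c0 com [[l1 l2 l3] [r1 r2 r3] [p2 p3] [d2 d3]].
(* At weight 0 any feasible production serves as the scaled point. *)
have [cE|cn0] := eqVneq c 0.
  exists (point3 (Clo * y1) (Clo * y2) (Clo * y3) y1 y2 y3 u2 u3).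
    apply/P3E => //; split=> //.
    case: com => -[yB1 yB2 yB3] _ _ _.
    have box y : y = 0 \/ y = 1 -> Clo * y <= Cup * y.
      by move=> yB; apply: ler_wpM2r; [case: yB => -> | lra].
    have ramp y y' : y = 0 \/ y = 1 -> y' = 0 \/ y' = 1 ->
        Clo * y' - Clo * y <= V * y + Vbar * (1 - y).
      by move=> [] -> [] ->; lra.
    rewrite /production3 !mul1r; do !split;
      by first [exact: lexx | exact: box | exact: ramp].
  (* At weight 0 the lower and upper bounds pin x to 0. *)
  rewrite point3Z; rewrite cE !mul0r in l1 l2 l3 r1 r2 r3 *.
  by congr point3; lra.
have cgt0 : 0 < c by rewrite lt_neqAle eq_sym cn0.
exists (point3 (c^-1 * x1) (c^-1 * x2) (c^-1 * x3) y1 y2 y3 u2 u3); last first.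
  by rewrite point3Z !mulVKf.
apply/P3E => //; split=> //.
by split; try split; rewrite mul1r -?mulrBr ?(ler_pdivlMl, ler_pdivrMl).
Qed.

Lemma commitment3_cases (R : realDomainType) (y1 y2 y3 u2 u3 : R) :
  commitment3 y1 y2 y3 u2 u3 ->
  [\/ [\/ [/\ y1 = 0, y2 = 0, y3 = 0, u2 = 0 & u3 = 0],
          [/\ y1 = 1, y2 = 0, y3 = 0, u2 = 0 & u3 = 0] |
          [/\ y1 = 1, y2 = 1, y3 = 0, u2 = 0 & u3 = 0]],
      [/\ y1 = 1, y2 = 1, y3 = 1, u2 = 0 & u3 = 0],
      [/\ y1 = 0, y2 = 1, y3 = 1, u2 = 1 & u3 = 0] |
      [/\ y1 = 0, y2 = 0, y3 = 1, u2 = 0 & u3 = 1]].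
Proof.
move=> [[+ + +] [+ +] [h1 h2] [h3 h4]].
case=> E1 [] E2 [] E3 [] E4 [] E5; rewrite E1 E2 E3 E4 E5 in h1 h2 h3 h4.
all: first [exfalso; lra
  | by apply: Or41; first [exact: Or31 | exact: Or32 | exact: Or33]
  | exact: Or42 | exact: Or43 | exact: Or44].
Qed.

(** * The inequalities of the theorem: validity on [P] and convexity *)

Definition facets (R : numDomainType) (Clo Cup Vbar V : R)
    (x1 x2 x3 y1 y2 y3 u2 u3 : R) : Prop :=
  u2 + u3 <= y3 /\
  y1 + u2 + u3 <= 1 /\
  u2 >= y2 - y1 /\
  u3 >= y3 - y2 /\
  u2 >= 0 /\
  u3 >= 0 /\
  x1 >= Clo * y1 /\
  x2 >= Clo * y2 /\
  x3 >= Clo * y3 /\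
  x1 <= Vbar * y1 + V * (y2 - u2) + (Cup - Vbar - V) * (y3 - u3 - u2) /\
  x2 <= Vbar * y2 + (Cup - Vbar) * (y3 - u3 - u2) /\
  x3 <= Cup * y3 - (Cup - Vbar) * u3 - (Cup - Vbar - V) * u2 /\
  x2 - x1 <= (Clo + V) * y2 - Clo * y1 - (Clo + V - Vbar) * u2 /\
  x3 - x2 <= (Clo + V) * y3 - Clo * y2 - (Clo + V - Vbar) * u3 /\
  x1 - x2 <= Vbar * y1 - (Vbar - V) * y2 - (Clo + V - Vbar) * u2 /\
  x2 - x3 <= Vbar * y2 - (Vbar - V) * y3 - (Clo + V - Vbar) * u3 /\
  x3 - x1 <= (Clo + 2 * V) * y3 - Clo * y1
             - (Clo + 2 * V - Vbar) * u3 - (Clo + V - Vbar) * u2 /\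
  x1 - x3 <= Vbar * y1 - Clo * y3 + V * (y2 - u2)
             + (Clo + V - Vbar) * (y3 - u3 - u2) /\
  x1 - x2 + x3 <= Vbar * y1 - (Vbar - V) * y2 + Vbar * y3
                  + (Cup - Vbar) * (y3 - u3 - u2) /\
  x1 - x2 + x3 >= Clo * y1 - (Clo + V) * y2 + Clo * y3.

(** Once the commitment is one of the six 0/1 patterns, every inequality is linear in x and the
    parameters. *)
Lemma facets_P3 (R : realDomainType) (Clo Cup Vbar V : R)
    x1 x2 x3 y1 y2 y3 u2 u3 :
  0 <= Clo -> 0 < V -> Clo + V <= Vbar -> 0 <= Cup - Vbar - V ->
  commitment3 y1 y2 y3 u2 u3 ->
  production3 Clo Cup Vbar V 1 y1 y2 y3 x1 x2 x3 ->
  facets Clo Cup Vbar V x1 x2 x3 y1 y2 y3 u2 u3.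
Proof.
move=> hClo hV hVbar hCup /commitment3_cases com.
rewrite /production3 !mul1r => -[[l1 l2 l3] [c1 c2 c3] [p2 p3] [d2 d3]].
case: com => [[]|||] [E1 E2 E3 E4 E5];
  rewrite E1 E2 E3 in l1 l2 l3 c1 c2 c3 p2 p3 d2 d3;
  rewrite /facets E1 E2 E3 E4 E5; clear E1 E2 E3 E4 E5; repeat split; lra.
Qed.

Lemma facets_convex (R : realDomainType) (Clo Cup Vbar V t : R)
    x1 x2 x3 y1 y2 y3 u2 u3 x1' x2' x3' y1' y2' y3' u2' u3'
    (s := 1 - t) :
  0 <= t -> t <= 1 ->
  facets Clo Cup Vbar V x1 x2 x3 y1 y2 y3 u2 u3 ->
  facets Clo Cup Vbar V x1' x2' x3' y1' y2' y3' u2' u3' ->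
  facets Clo Cup Vbar V (t * x1 + s * x1') (t * x2 + s * x2')
    (t * x3 + s * x3') (t * y1 + s * y1') (t * y2 + s * y2')
    (t * y3 + s * y3') (t * u2 + s * u2') (t * u3 + s * u3').
Proof.
move=> t0 t1; rewrite /facets {}/s.
have comb (l r l' r' : R) : l <= r -> l' <= r' ->
    t * l + (1 - t) * l' <= t * r + (1 - t) * r'.
  by move=> h h'; rewrite lerD // ler_wpM2l // subr_ge0.
(* All twenty inequalities are affine in the point, so each combined one agrees with its goal up to
   distributivity. *)
do 19! (move=> [h H] [h' H']; split;
  [by have := comb _ _ _ _ h h'; clear; lra | move: {h h'} H H']).
by move=> h h'; have := comb _ _ _ _ h h'; clear; lra.
Qed.

(** * From the inequalities to the convex hull *)

Lemma modes_hull (R : realType) (Clo Cup Vbar V a b c d e : R)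
    xa xb1 xb2 xc1 xc2 xc3 xd2 xd3 xe :
  0 <= Clo -> 0 < V -> Clo + V <= Vbar -> 0 <= Cup - Vbar - V ->
  0 <= a -> 0 <= b -> 0 <= c -> 0 <= d -> 0 <= e -> a + b + c + d + e <= 1 ->
  a * Clo <= xa <= a * Vbar -> e * Clo <= xe <= e * Vbar ->
  b * Clo <= xb2 <= b * Vbar ->
  [/\ b * Clo <= xb1, xb2 - b * V <= xb1 & xb1 <= xb2 + b * V] ->
  d * Clo <= xd2 <= d * Vbar ->
  [/\ d * Clo <= xd3, xd2 - d * V <= xd3 & xd3 <= xd2 + d * V] ->
  c * Clo <= xc2 <= c * Cup ->
  [/\ c * Clo <= xc1, xc2 - c * V <= xc1, xc1 <= c * Cup & xc1 <= xc2 + c * V] ->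
  [/\ c * Clo <= xc3, xc2 - c * V <= xc3, xc3 <= c * Cup & xc3 <= xc2 + c * V] ->
  convex_hull (P 3 2 2 Clo Cup Vbar V)
    (point3 (xa + xb1 + xc1) (xb2 + xc2 + xd2) (xe + xd3 + xc3)
      (a + b + c) (b + c + d) (c + d + e) d e).
Proof.
move=> hClo hV hVbar hCup a0 b0 c0 d0 e0.
have ClV : Clo <= Vbar by lra.
have VC : Vbar <= Cup by lra.
have nnM w : 0 <= w ->
    [/\ 0 <= w * (Cup - Vbar - V), 0 <= w * V, 0 <= w * Clo & 0 <= w * Vbar].
  by move=> w0; split; apply: mulr_ge0 => //; lra.
(* The remaining weight [o] goes to the commitment that is off throughout. *)
rewrite -subr_ge0; set o := 1 - _ => o0 Ha He Hb Hb1 Hd Hd3 Hc Hc1 Hc3.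
pose K := convex_hull (P 3 2 2 Clo Cup Vbar V).
have cK : convex_set K := @convex_set_hull _ _ _.
have mode w z1 z2 z3 v1 v2 v3 s2 s3 : 0 <= w ->
    production3 Clo Cup Vbar V w v1 v2 v3 z1 z2 z3 ->
    commitment3 v1 v2 v3 s2 s3 ->
    scaled K w (point3 z1 z2 z3 (w * v1) (w * v2) (w * v3) (w * s2) (w * s3)).
  move=> w0 prod com.
  have [v Pv ->] := scaled_P3 hClo hV ClV VC w0 com prod.
  by exists v => //; apply: sub_gen_smallest.
have Ma : production3 Clo Cup Vbar V a 1 0 0 xa 0 0.
  by move: (nnM a a0) Ha; clear => -[? ? ? ?] /andP[? ?]; repeat split; lra.
(* The bound by [Cup] in period 1 comes from [xb1 <= xb2 + b * V <= b * (Vbar + V) <= b * Cup];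
   likewise for [xd3] in [Md]. *)
have Mb : production3 Clo Cup Vbar V b 1 1 0 xb1 xb2 0.
  move: (nnM b b0) Hb Hb1; clear => -[? ? ? ?] /andP[? ?] [? ? ?].
  by repeat split; lra.
have Mc : production3 Clo Cup Vbar V c 1 1 1 xc1 xc2 xc3.
  move: Hc Hc1 Hc3; clear => /andP[? ?] [? ? ? ?] [? ? ? ?].
  by repeat split; lra.
have Md : production3 Clo Cup Vbar V d 0 1 1 0 xd2 xd3.
  move: (nnM d d0) Hd Hd3; clear => -[? ? ? ?] /andP[? ?] [? ? ?].
  by repeat split; lra.
have Me : production3 Clo Cup Vbar V e 0 0 1 0 0 xe.
  by move: (nnM e e0) He; clear => -[? ? ? ?] /andP[? ?]; repeat split; lra.
have Mo : production3 Clo Cup Vbar V o 0 0 0 0 0 0.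
  by move: (nnM o o0); clear => -[? ? ? ?]; repeat split; lra.
have addK := scaledD cK.
(* The six weights add up to 1, so the sum of the scaled points is a point of [K]. *)
have := addK _ _ _ _ _ o0
  (addK _ _ _ _ _ e0
    (addK _ _ _ _ _ d0
      (addK _ _ _ _ _ c0
        (addK _ _ _ _ a0 b0 (mode _ _ _ _ _ _ _ 0 0 a0 Ma _)
          (mode _ _ _ _ _ _ _ 0 0 b0 Mb _))
        (mode _ _ _ _ _ _ _ 0 0 c0 Mc _))
      (mode _ _ _ _ _ _ _ 1 0 d0 Md _))
    (mode _ _ _ _ _ _ _ 0 1 e0 Me _))
  (mode _ _ _ _ _ _ _ 0 0 o0 Mo _).
case; rewrite ?addr_ge0 //.
1-6: by clear; repeat split; first [by left | by right | lra].
move=> v Kv.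
rewrite [_ + o]addrC subrK scale1r !point3D => vE.
rewrite -/K; suff -> : point3 (xa + xb1 + xc1) (xb2 + xc2 + xd2)
  (xe + xd3 + xc3) (a + b + c) (b + c + d) (c + d + e) d e = v by [].
by rewrite -vE; congr point3; clear; lra.
Qed.

Lemma facets_hull (R : realType) (Clo Cup Vbar V : R)
    x1 x2 x3 y1 y2 y3 u2 u3 :
  0 <= Clo -> 0 < V -> Clo + V <= Vbar -> 0 <= Cup - Vbar - V ->
  facets Clo Cup Vbar V x1 x2 x3 y1 y2 y3 u2 u3 ->
  convex_hull (P 3 2 2 Clo Cup Vbar V) (point3 x1 x2 x3 y1 y2 y3 u2 u3).
Proof.
move=> hClo hV hVbar hCup.
move=> [k1 [k2 [k3 [k4 [k5 [k6 [i1 [i2 [i3 [i4 [i5 [i6]]]]]]]]]]]].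
move=> [i7 [i8 [i9 [i10 [i11 [i12 [i13 i14]]]]]]].
pose a := y1 - y2 + u2; pose b := y2 - y3 + u3; pose c := y3 - u3 - u2.
have y3E : y3 = c + u2 + u3 by rewrite /c; lra.
have y2E : y2 = b + c + u2 by rewrite /b /c; lra.
have y1E : y1 = a + b + c by rewrite /a /b /c; lra.
have a0 : 0 <= a by rewrite /a; lra.
have b0 : 0 <= b by rewrite /b; lra.
have c0 : 0 <= c by rewrite /c; lra.
have o0 : 0 <= 1 - (a + b + c + u2 + u3) by rewrite /a /b /c; lra.
(* From here on the weights are the unknowns; [u2] and [u3] are themselves weights. *)
clearbody a b c; subst y1 y2 y3; clear k1 k2 k3 k4.
(* Products of a weight and a parameter are nonlinear, so [lra] is given their signs. *)
have ge0M w : 0 <= w -> [/\ 0 <= w * Clo, 0 <= w * V,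
    0 <= w * (Vbar - V - Clo) & 0 <= w * (Cup - Vbar - V)].
  by move=> w0; split; apply: mulr_ge0 => //; lra.
have [a1 a2 a3 a4] := ge0M a a0; have [b1 b2 b3 b4] := ge0M b b0.
have [c1 c2 c3 c4] := ge0M c c0; have [d1 d2 d3 d4] := ge0M u2 k5.
have [e1 e2 e3 e4] := ge0M u3 k6.
(* Productions next to an off period are capped by [Vbar]; in mode 111 the cap is [Cup]. The premise
   [cL + 2 * cV <= cU] amounts to Clo + 2 V <= Cup, the sum of [hVbar] and [hCup]. *)
have := @production_split R (a * Clo) (a * Vbar)
  (b * Clo) (b * Vbar) (b * V) (c * Clo) (c * Cup) (c * V)
  (u2 * Clo) (u2 * Vbar) (u2 * V) (u3 * Clo) (u3 * Vbar) x1 x2 x3.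
(* Premises comparing the bounds follow from the signs; those on x1, x2, x3 are the assumed
   inequalities rewritten in the weights. *)
case; first [done
  | move: a1 a2 a3 b1 b2 b3 c1 c2 c3 c4 d1 d2 d3 e1 e2 e3; clear; lra
  | clear a1 a2 a3 a4 b1 b2 b3 b4 c1 c2 c3 c4 d1 d2 d3 d4 e1 e2 e3 e4;
    lra | idtac].
clear i1 i2 i3 i4 i5 i6 i7 i8 i9 i10 i11 i12 i13 i14.
move=> xa [xb1 [xb2 [xc1 [xc2 [xc3 [xd2 [xd3 [xe]]]]]]]].
move=> [[<- <- <-] [Ha He] [Hb Hb1] [Hd Hd3] [Hc Hc1 Hc3]].
by apply: modes_hull => //; rewrite -subr_ge0.
Qed.

Theorem theorem8 (R : realType) (Clo Cup Vbar V : R)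
    (hClo : 0 <= Clo) (hCloVbar : Clo <= Vbar) (hVbarCup : Vbar <= Cup)
    (hV : 0 < V)
    (hVbar : Clo + V <= Vbar) (hCup : 0 <= Cup - Vbar - V) :
  convex_hull (P 3 2 2 Clo Cup Vbar V) =
  [set p : schedule R 3 |
    let x1 := xvar p 1 in let x2 := xvar p 2 in let x3 := xvar p 3 in
    let y1 := yvar p 1 in let y2 := yvar p 2 in let y3 := yvar p 3 in
    let u2 := uvar p 2 in let u3 := uvar p 3 in
    u2 + u3 <= y3 /\
    y1 + u2 + u3 <= 1 /\
    u2 >= y2 - y1 /\
    u3 >= y3 - y2 /\
    u2 >= 0 /\
    u3 >= 0 /\
    x1 >= Clo * y1 /\
    x2 >= Clo * y2 /\
    x3 >= Clo * y3 /\
    x1 <= Vbar * y1 + V * (y2 - u2) + (Cup - Vbar - V) * (y3 - u3 - u2) /\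
    x2 <= Vbar * y2 + (Cup - Vbar) * (y3 - u3 - u2) /\
    x3 <= Cup * y3 - (Cup - Vbar) * u3 - (Cup - Vbar - V) * u2 /\
    x2 - x1 <= (Clo + V) * y2 - Clo * y1 - (Clo + V - Vbar) * u2 /\
    x3 - x2 <= (Clo + V) * y3 - Clo * y2 - (Clo + V - Vbar) * u3 /\
    x1 - x2 <= Vbar * y1 - (Vbar - V) * y2 - (Clo + V - Vbar) * u2 /\
    x2 - x3 <= Vbar * y2 - (Vbar - V) * y3 - (Clo + V - Vbar) * u3 /\
    x3 - x1 <= (Clo + 2 * V) * y3 - Clo * y1
               - (Clo + 2 * V - Vbar) * u3 - (Clo + V - Vbar) * u2 /\
    x1 - x3 <= Vbar * y1 - Clo * y3 + V * (y2 - u2)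
               + (Clo + V - Vbar) * (y3 - u3 - u2) /\
    x1 - x2 + x3 <= Vbar * y1 - (Vbar - V) * y2 + Vbar * y3
                    + (Cup - Vbar) * (y3 - u3 - u2) /\
    x1 - x2 + x3 >= Clo * y1 - (Clo + V) * y2 + Clo * y3].
Proof.
apply/seteqP; split=> [|p /=]; last first.
  by rewrite [p in convex_hull _ p]point3_eta; exact: facets_hull.
(* It remains that the right-hand side is convex and contains [P]. *)
apply: smallest_sub.
  apply/convex_setP => p q t t0 t1; rewrite (point3_eta p) (point3_eta q).
  by rewrite /= !point3Z point3D !point3_coords; exact: facets_convex.
move=> p; rewrite (point3_eta p) => /(P3E _ _ _ _ _ _ _ _ _ _ _ hClo)[com prod].
rewrite /= !point3_coords.
exact: facets_P3.
Qed.
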